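(* Let $X$ be a rack and let $n\ge 1$. (i) For any $a\in X$, the map $*_a\colon C_n^R(X)\to C_n^R(X)$ is a chain map which is chain homotopic to the identity. (ii) If $a\in X$ satisfies the $k$-condition, then $h'_a\colon C_n^R(X)\to C_{n+1}^R(X)$ is a chain map. Moreover, if $X$ is finite, then every $a\in X$ satisfies the $k$-condition for some $k$. (iii) If $X$ is a quandle and $a \in X$, then $h_a(C_n^D(X))\subset C_{n+1}^D(X)$ and $*_a(C_n^D(X))\subset C_n^D(X)$. Therefore the maps $h_a, h'_a\colon C_n^Q(X)\to C_{n+1}^Q(X)$ and $*_a\colon C_n^Q(X)\to C_n^Q(X)$ are well defined (for $h'_a$, $a$ is assumed to satisfy the $k$-condition). Furthermore, on $C^Q_*(X)$ the maps $*_a$ and $h'_a$ are chain maps, and $*_a$ is chain homotopic to the identity. (iv) If $a$ and $b$ (satisfying the $k$-condition) are in the same orbit of $X$, then $h'_a$ and $h'_b$ induce the same map on homology, that is, $(h'_a)_*=(h'_b)_*\colon H_n^W(X)\to H_{n+1}^W(X)$, where $W=R$, $Q$ or $D$ (with $X$ a quandle when $W=Q$ or $D$).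
   Context: A rack is a set $X$ with a binary operation $*$ such that for all $a,b$ there is a unique $c$ with $a=c*b$, and $(a*b)*c=(a*c)*(b*c)$ for all $a,b,c$. A quandle is a rack with $a*a=a$ for all $a$. Products are left-normed: $a*b*c=(a*b)*c$; and $x*a^k$ means $x*a*\cdots*a$ ($k$ copies of $a$). The orbits of $X$ are the orbits of the group generated by the bijections $x\mapsto x*b$, $b\in X$. For $n\ge1$, $C_n^R(X)=\mathbb{Z}X^n$ is the free abelian group on $n$-tuples $(x_1,\ldots,x_n)$, with boundary $\partial\colon C_n^R(X)\to C_{n-1}^R(X)$, $$\partial(x_1,\ldots,x_n)=\sum_{i=2}^n(-1)^i\big((x_1,\ldots,x_{i-1},x_{i+1},\ldots,x_n)-(x_1*x_i,\ldots,x_{i-1}*x_i,x_{i+1},\ldots,x_n)\big),$$ which is zero for $n=1$. If $X$ is a quandle, $C_n^D(X)\subset C_n^R(X)$ is the subgroup generated by tuples with $x_i=x_{i+1}$ for some $i$ (a subcomplex), and $C_n^Q(X)=C_n^R(X)/C_n^D(X)$. The homology groups are denoted $H_n^R(X),H_n^D(X),H_n^Q(X)$. For $a\in X$: $*_a(x_1,\ldots,x_n)=(x_1*a,\ldots,x_n*a)$ and $h_a(x_1,\ldots,x_n)=(x_1,\ldots,x_n,a)$, extended linearly. An element $a$ satisfies the $k$-condition ($k\geq 1$) if $x*a^k=x$ for all $x\in X$; for such $a$, $h'_a=h_a+*_ah_a+( *_a)^2h_a+\cdots+( *_a)^{k-1}h_a$. A chain map of degree $d$ is a family of homomorphisms $C_n\to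 C_{n+d}$ commuting with the boundaries. *)

(* Defs.v *)
From HB Require Import structures.
From mathcomp Require Import freeg.
From mathcomp Require Import all_boot all_order all_algebra.
From mathcomp Require Import boolp generic_quotient.

Set Implicit Arguments.
Unset Strict Implicit.
Unset Printing Implicit Defensive.

Import GRing.Theory.
Local Open Scope ring_scope.
Local Open Scope quotient_scope.

Inductive generated (V : zmodType) (A : V -> Prop) : V -> Prop :=
| generated_in x : A x -> generated A x
| generated0 : generated A 0
| generatedB x y : generated A x -> generated A y -> generated A (x - y).

Definition gen_subgroup (V : zmodType) (A : V -> Prop) : {pred V} :=
  [pred x | `[< generated A x >]].

Section GenSubgroup.
Variables (V : zmodType) (A : V -> Prop).

Lemma gen_subgroupP x : reflect (generated A x) (x \in gen_subgroup A).
Proof. exact: asboolP. Qed.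

Fact gen_subgroup_zmod_closed : zmod_closed (gen_subgroup A).
Proof.
split=> [|x y /gen_subgroupP Ax /gen_subgroupP Ay]; apply/gen_subgroupP.
  exact: generated0.
exact: generatedB.
Qed.

HB.instance Definition _ :=
  GRing.isZmodClosed.Build V (gen_subgroup A) gen_subgroup_zmod_closed.

End GenSubgroup.

Definition subgroup_type (V : zmodType) (S : zmodClosed V) : Type :=
  {x : V | x \in S}.

HB.instance Definition _ (V : zmodType) (S : zmodClosed V) :=
  SubChoice.on (subgroup_type S).
HB.instance Definition _ (V : zmodType) (S : zmodClosed V) :=
  [SubChoice_isSubZmodule of subgroup_type S by <:].

Definition quot_pi (V : zmodType) (S : zmodClosed V) (x : V) : {ideal_quot S} :=
  \pi_{ideal_quot S} x.

Fact quot_pi_zmod_morphism (V : zmodType) (S : zmodClosed V) :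
  zmod_morphism (@quot_pi V S).
Proof. by move=> x y; apply: raddfB. Qed.

HB.instance Definition _ (V : zmodType) (S : zmodClosed V) :=
  GRing.isZmodMorphism.Build V {ideal_quot S} (@quot_pi V S)
    (@quot_pi_zmod_morphism V S).

Lemma quot_piP (V : zmodType) (S : zmodClosed V) (x y : V) :
  quot_pi S x = quot_pi S y <-> x - y \in S.
Proof. by rewrite Quotient.idealrBE; split=> /eqP. Qed.

Lemma quot_repr (V : zmodType) (S : zmodClosed V) (x : {ideal_quot S}) :
  quot_pi S (repr x) = x.
Proof. exact: reprK. Qed.

(* The complexes of interest start in degree 1, and degree 0 only serves as
   the target of the boundary map out of degree 1.  Thus [bd C n] leaves the
   group of degree n + 1, and the notions below (squares of a chain map,
   homotopy identity, homology groups) are about degrees n + 1 only. *)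
Record chain_complex := ChainComplex {
  grp :> nat -> zmodType;
  bd : forall n, {additive grp n.+1 -> grp n};
  bdK : forall n x, bd n (bd n.+1 x) = 0 }.

Definition shift (C : chain_complex) : chain_complex :=
  @ChainComplex (fun n => C n.+1) (fun n => bd C n.+1) (fun n => bdK (n := n.+1)).

(* A chain map of degree 1 from C to D is a [chain_map C (shift D)]. *)
Record chain_map (C D : chain_complex) := ChainMap {
  cmap :> forall n, {additive C n -> D n};
  cmapE : forall n x, cmap n (bd C n x) = bd D n (cmap n.+1 x) }.

Definition chain_id (C : chain_complex) : chain_map C C :=
  @ChainMap C C (fun n => idfun) (fun n x => erefl).

Definition chain_homotopic (C D : chain_complex) (f g : chain_map C D) :=
  exists s : forall n, {additive C n -> D n.+1},
    forall n x, f n.+1 x - g n.+1 x = bd D n.+1 (s n.+1 x) + s n (bd C n x).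

Section Homology.
Variables (C : chain_complex) (n : nat).

Definition cycle_pred : {pred C n.+1} := [pred x | bd C n x == 0].

Fact cycle_zmod_closed : zmod_closed cycle_pred.
Proof.
by split=> [|x y]; rewrite !inE ?raddf0 // raddfB => /eqP-> /eqP->; rewrite subr0.
Qed.

HB.instance Definition _ :=
  GRing.isZmodClosed.Build (C n.+1) cycle_pred cycle_zmod_closed.

Definition cycles : zmodType := subgroup_type cycle_pred.

Definition boundary_pred : {pred cycles} :=
  [pred z : cycles | `[< exists y, bd C n.+1 y = val z >]].

Fact boundary_zmod_closed : zmod_closed boundary_pred.
Proof.
split=> [|x y /asboolP [u xE] /asboolP [v yE]]; apply/asboolP.
  by exists 0; rewrite raddf0.
by exists (u - v); rewrite raddfB xE yE.
Qed.

HB.instance Definition _ :=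
  GRing.isZmodClosed.Build cycles boundary_pred boundary_zmod_closed.

(* This is H_{n+1}(C) = ker (C_{n+1} -> C_n) / im (C_{n+2} -> C_{n+1}). *)
Definition homology : zmodType := {ideal_quot boundary_pred}.

Definition homology_class (z : cycles) : homology := quot_pi boundary_pred z.

End Homology.

Section HomologyMap.
Variables (C D : chain_complex) (f : chain_map C D) (n : nat).

Fact cycle_map_subproof (z : cycles C n) :
  f n.+1 (val z) \in cycle_pred (n := n).
Proof. by case: z => x /= /eqP xP; rewrite inE -cmapE xP raddf0. Qed.

Definition cycle_map (z : cycles C n) : cycles D n :=
  exist _ (f n.+1 (val z)) (cycle_map_subproof z).

Definition homology_map (x : homology C n) : homology D n :=
  homology_class (cycle_map (repr x)).

Lemma homology_map_class (z : cycles C n) :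
  homology_map (homology_class z) = homology_class (cycle_map z).
Proof.
apply/quot_piP.
have /quot_piP/asboolP[y yE] := quot_repr (homology_class z).
by apply/asboolP; exists (f n.+2 y); rewrite -cmapE yE !raddfB.
Qed.

End HomologyMap.

Arguments homology_map {C D} f n x.

Section SubQuotient.
Variable C : chain_complex.

Record subcomplex := Subcomplex {
  sgrp :> forall n, zmodClosed (C n);
  sgrp_bd : forall n x, x \in sgrp n.+1 -> bd C n x \in sgrp n }.

Variable S : subcomplex.

Section Sub.
Variable n : nat.
Definition sub_bd (x : subgroup_type (S n.+1)) : subgroup_type (S n) :=
  exist _ (bd C n (val x)) (sgrp_bd (valP x)).

Fact sub_bd_zmod_morphism : zmod_morphism sub_bd.
Proof. by move=> x y; apply: val_inj; rewrite /= !raddfB. Qed.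

HB.instance Definition _ := GRing.isZmodMorphism.Build
  (subgroup_type (S n.+1)) (subgroup_type (S n)) sub_bd sub_bd_zmod_morphism.
End Sub.

Fact sub_bdK n x : sub_bd (n := n) (sub_bd (n := n.+1) x) = 0.
Proof. by apply: val_inj; rewrite /= bdK. Qed.

Definition sub_complex : chain_complex :=
  @ChainComplex (fun n => subgroup_type (S n)) (fun n => @sub_bd n) sub_bdK.

Section Quot.
Variable n : nat.

Definition quot_bd (x : {ideal_quot S n.+1}) : {ideal_quot S n} :=
  quot_pi (S n) (bd C n (repr x)).

Lemma quot_bd_pi (x : C n.+1) :
  quot_bd (quot_pi (S n.+1) x) = quot_pi (S n) (bd C n x).
Proof.
by apply/quot_piP; rewrite -raddfB; apply/sgrp_bd/quot_piP/quot_repr.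
Qed.

Fact quot_bd_zmod_morphism : zmod_morphism quot_bd.
Proof.
move=> x y; rewrite -[x]quot_repr -[y]quot_repr -raddfB.
by rewrite !quot_bd_pi !raddfB.
Qed.

HB.instance Definition _ := GRing.isZmodMorphism.Build
  {ideal_quot S n.+1} {ideal_quot S n} quot_bd quot_bd_zmod_morphism.
End Quot.

Fact quot_bdK n x : quot_bd (n := n) (quot_bd (n := n.+1) x) = 0.
Proof. by rewrite -[x]quot_repr !quot_bd_pi bdK raddf0. Qed.

Definition quot_complex : chain_complex :=
  @ChainComplex (fun n => {ideal_quot S n}) (fun n => @quot_bd n) quot_bdK.

End SubQuotient.

HB.mixin Record isRack X of Choice X := {
  rack_op : X -> X -> X;
  rack_op_bij : forall a b, exists! c, a = rack_op c b;
  rack_op_distr : forall a b c,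
    rack_op (rack_op a b) c = rack_op (rack_op a c) (rack_op b c) }.

#[short(type="rackType")]
HB.structure Definition Rack := {X of isRack X & Choice X}.

HB.mixin Record isQuandle X of Rack X := {
  rack_op_idem : forall a : X, rack_op a a = a }.

#[short(type="quandleType")]
HB.structure Definition Quandle := {X of isQuandle X & Rack X}.

Notation "x ** y" := (rack_op x y) (at level 40, left associativity).

Definition k_condition (X : rackType) (a : X) (k : nat) :=
  (0 < k)%N /\ forall x, iter k (fun y => y ** a) x = x.

Inductive translation_group (X : rackType) : (X -> X) -> Prop :=
| translation_gen b : translation_group (fun x => x ** b)
| translation1 : translation_group id
| translationM f g :
    translation_group f -> translation_group g -> translation_group (f \o g)
| translationV f g :
    translation_group f -> cancel f g -> cancel g f -> translation_group g.

Definition same_orbit (X : rackType) (a b : X) :=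
  exists2 f, translation_group f & f a = b.

Section RackComplex.
Variable X : rackType.

Definition rack_chain (n : nat) : zmodType := {freeg (n.-tuple X)}.

Section Faces.
Variables (n : nat) (i : 'I_n.+1) (t : n.+1.-tuple X).

Definition face : n.-tuple X := [tuple tnth t (lift i j) | j < n].

Definition act_face : n.-tuple X :=
  [tuple (if (j < i)%N then tnth t (lift i j) ** tnth t i
          else tnth t (lift i j)) | j < n].
End Faces.

(* Indices start at 0 here, so the term of index i removes the entry x_{i+1},
   and has sign (-1)^(i+1). *)
Definition rack_bd_tuple n (t : n.+1.-tuple X) : {freeg (n.-tuple X)} :=
  \sum_(i < n.+1 | (0 < i)%N)
    (-1) ^+ i.+1 *: (<< face i t >> - << act_face i t >>).

Definition rack_bd n : rack_chain n.+1 -> rack_chain n :=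
  fglift (@rack_bd_tuple n).

Definition star_map (a : X) n : rack_chain n -> rack_chain n :=
  fglift (fun t : n.-tuple X => << map_tuple (fun x => x ** a) t >>).

Definition h_map (a : X) n : rack_chain n -> rack_chain n.+1 :=
  fglift (fun t : n.-tuple X => << [tuple of rcons t a] >>).

Definition h'_map (a : X) (k : nat) n (c : rack_chain n) : rack_chain n.+1 :=
  \sum_(i < k) iter i (@star_map a n.+1) (h_map a c).

HB.instance Definition _ n := GRing.isZmodMorphism.Build
  (rack_chain n.+1) (rack_chain n) (@rack_bd n)
  (lift_is_additive (@rack_bd_tuple n)).

HB.instance Definition _ (a : X) n := GRing.isZmodMorphism.Build
  (rack_chain n) (rack_chain n) (@star_map a n)
  (lift_is_additive (fun t : n.-tuple X => << map_tuple (fun x => x ** a) t >>)).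

HB.instance Definition _ (a : X) n := GRing.isZmodMorphism.Build
  (rack_chain n) (rack_chain n.+1) (@h_map a n)
  (lift_is_additive (fun t : n.-tuple X => << [tuple of rcons t a] >>)).

Lemma freeg_additive_ext (K : choiceType) (V : zmodType)
    (f g : {additive {freeg K} -> V}) :
  (forall x, f << x >> = g << x >>) -> f =1 g.
Proof.
move=> fg D; rewrite -[D]freeg_sumE !raddf_sum; apply: eq_bigr => z _.
by rewrite -[coeff z D]intz -freegU_mulz !raddfMz fg.
Qed.

Lemma rack_bdU n (t : n.+1.-tuple X) : rack_bd << t >> = rack_bd_tuple t.
Proof. by rewrite /rack_bd liftU scale1r. Qed.

Lemma star_mapU a n (t : n.-tuple X) :
  star_map a << t >> = << map_tuple (fun x => x ** a) t >>.
Proof. by rewrite /star_map liftU scale1r. Qed.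

Lemma h_mapU a n (t : n.-tuple X) : h_map a << t >> = << [tuple of rcons t a] >>.
Proof. by rewrite /h_map liftU scale1r. Qed.

Lemma nth_face x0 n (i : 'I_n.+1) (t : n.+1.-tuple X) j :
  (j < n)%N -> nth x0 (face i t) j = nth x0 t (bump i j).
Proof.
by move=> jn; rewrite -(tnth_nth x0 _ (Ordinal jn)) tnth_mktuple (tnth_nth x0).
Qed.

Lemma nth_act_face x0 n (i : 'I_n.+1) (t : n.+1.-tuple X) j :
  (j < n)%N -> nth x0 (act_face i t) j =
  if (j < i)%N then nth x0 t j ** nth x0 t i else nth x0 t j.+1.
Proof.
move=> jn; rewrite -(tnth_nth x0 _ (Ordinal jn)) tnth_mktuple !(tnth_nth x0) /=.
by rewrite /bump; case: ltnP.
Qed.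

Lemma face_rcons n (i : 'I_n.+1) (t : n.+1.-tuple X) (a : X) :
  face (widen_ord (leqnSn _) i) [tuple of rcons t a] = [tuple of rcons (face i t) a].
Proof.
apply: eq_from_tnth => j; rewrite !(tnth_nth a) nth_face // !nth_rcons !size_tuple /=.
have := ltn_ord j; rewrite ltnS leq_eqVlt => /predU1P[->|jn].
  by rewrite /bump (leq_ord i) add1n !ltnn !eqxx.
rewrite jn nth_face //; suff -> : (bump i j < n.+1)%N by [].
by rewrite /bump; case: (leqP i j) => _; [exact: jn | exact: ltnW].
Qed.

Lemma act_face_rcons n (i : 'I_n.+1) (t : n.+1.-tuple X) (a : X) :
  act_face (widen_ord (leqnSn _) i) [tuple of rcons t a]
  = [tuple of rcons (act_face i t) a].
Proof.
apply: eq_from_tnth => j; rewrite !(tnth_nth a) nth_act_face // !nth_rcons !size_tuple /=.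
have := ltn_ord j; rewrite ltnS leq_eqVlt => /predU1P[->|jn].
  by rewrite ltnNge (leq_ord i) /= !ltnn !eqxx.
rewrite jn nth_act_face // !ltn_ord (_ : (j.+1 < n.+1)%N = (j < n)%N) // jn.
by rewrite orbT.
Qed.

Lemma face_last n (t : n.-tuple X) (a : X) :
  face ord_max [tuple of rcons t a] = t.
Proof.
apply: eq_from_tnth => j; rewrite !(tnth_nth a) nth_face //= nth_rcons size_tuple.
by rewrite /bump [(n <= j)%N]leqNgt ltn_ord /= add0n ltn_ord.
Qed.

Lemma act_face_last n (t : n.-tuple X) (a : X) :
  act_face ord_max [tuple of rcons t a] = map_tuple (fun x => x ** a) t.
Proof.
apply: eq_from_tnth => j; rewrite [RHS]tnth_map !(tnth_nth a) nth_act_face //=.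
by rewrite !nth_rcons !size_tuple ltn_ord ltnn eqxx.
Qed.

Lemma rack_bd0 (c : rack_chain 1) : rack_bd c = 0.
Proof.
apply: (freeg_additive_ext (f := @rack_bd 0) (g := \0)) => t /=.
by rewrite rack_bdU /rack_bd_tuple big_mkcond big_ord1.
Qed.

Lemma rack_bd_h a n (c : rack_chain n.+1) :
  rack_bd (h_map a c) = h_map a (rack_bd c) + (-1) ^+ n *: (c - star_map a c).
Proof.
move: c; apply: (freeg_additive_ext (f := @rack_bd n.+1 \o @h_map a n.+1)
  (g := (@h_map a n \o @rack_bd n) \+
        ( *:%R ((-1) ^+ n) \o (idfun \- @star_map a n.+1)))) => t /=.
rewrite h_mapU rack_bdU star_mapU rack_bdU /rack_bd_tuple big_mkcond big_ord_recr /=.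
rewrite face_last act_face_last exprSr exprSr mulrN1 mulrN1 opprK; congr (_ + _).
rewrite raddf_sum [RHS]big_mkcond; apply: eq_bigr => i _ /=; case: ifP => // _.
by rewrite face_rcons act_face_rcons raddfZsign (raddfB (@h_map a n)) /= !h_mapU.
Qed.

Lemma rack_bd_star a n (c : rack_chain n.+1) :
  rack_bd (star_map a c) = star_map a (rack_bd c).
Proof.
move: c; apply: (freeg_additive_ext (f := @rack_bd n \o @star_map a n.+1)
  (g := @star_map a n \o @rack_bd n)) => t /=.
rewrite star_mapU !rack_bdU raddf_sum; apply: eq_bigr => i _.
rewrite raddfZsign (raddfB (@star_map a n)) /= !star_mapU.
congr (_ *: (<< _ >> - << _ >>)).
  by apply: eq_from_tnth => j; rewrite [RHS]tnth_map !tnth_mktuple tnth_map.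
apply: eq_from_tnth => j; rewrite [RHS]tnth_map !tnth_mktuple !tnth_map.
by case: ifP => // _; rewrite -rack_op_distr.
Qed.

Lemma tuple_rconsP n (t : n.+1.-tuple X) :
  exists (u : n.-tuple X) (a : X), t = [tuple of rcons u a].
Proof.
case: t => s; case/lastP: s => // s a sz.
have sn : size s == n by rewrite size_rcons eqSS in sz.
by exists (Tuple sn), a; apply: val_inj.
Qed.

Lemma rack_bdK n (c : rack_chain n.+2) : rack_bd (rack_bd c) = 0.
Proof.
move: c; elim: n => [|n IH] c; first by rewrite rack_bd0.
move: c; apply: (freeg_additive_ext (f := @rack_bd n.+1 \o @rack_bd n.+2) (g := \0)).
move=> t /=; have [u [a ->]] := tuple_rconsP t; rewrite -h_mapU.
rewrite rack_bd_h raddfD raddfZsign raddfB /= rack_bd_h IH raddf0 add0r.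
by rewrite rack_bd_star exprS mulN1r scaleNr subrr.
Qed.

Definition rack_complex : chain_complex :=
  @ChainComplex rack_chain (fun n => @rack_bd n) rack_bdK.

End RackComplex.

Definition degenerate (T : Type) n (t : n.-tuple T) :=
  exists i j : 'I_n, j = i.+1 :> nat /\ tnth t i = tnth t j.

Section QuandleComplex.
Variable X : quandleType.

Definition degenerate_chain n : zmodClosed (rack_chain X n) :=
  gen_subgroup (fun c : rack_chain X n =>
    exists2 t : n.-tuple X, degenerate t & c = << t >>).

Lemma gen_subgroup_sub (V W : zmodType) (A : V -> Prop) (S : zmodClosed W)
    (f : {additive V -> W}) (x : V) :
  (forall y, A y -> f y \in S) -> x \in gen_subgroup A -> f x \in S.
Proof.
move=> AS /gen_subgroupP; elim=> [y /AS //||y z _ Sy _ Sz].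
  by rewrite raddf0 rpred0.
by rewrite raddfB rpredB.
Qed.

Lemma degenerate_mem n (t : n.-tuple X) :
  degenerate t -> << t >> \in degenerate_chain n.
Proof. by move=> dt; apply/gen_subgroupP/generated_in; exists t. Qed.

Lemma degenerate_rcons n (t : n.-tuple X) (a : X) :
  degenerate t -> degenerate [tuple of rcons t a].
Proof.
move=> [i [j [ji tij]]]; exists (widen_ord (leqnSn n) i), (widen_ord (leqnSn n) j).
by split=> //; move: tij; rewrite !(tnth_nth a) /= !nth_rcons size_tuple !ltn_ord.
Qed.

Lemma degenerate_rconsP n (t : n.+2.-tuple X) :
  degenerate t -> exists (u : n.+1.-tuple X) (a : X), t = [tuple of rcons u a] /\
    (degenerate u \/ exists v : n.-tuple X, u = [tuple of rcons v a]).
Proof.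
have [u [a ->]] := tuple_rconsP t; move=> [i [j [ji tij]]]; exists u, a; split=> //.
have := ltn_ord j; rewrite ltnS leq_eqVlt => /predU1P[jn|jn]; last first.
  have iN : (i < n.+1)%N by apply: ltnW; rewrite -ji.
  left; exists (Ordinal iN), (Ordinal jn); split=> //.
  by move: tij; rewrite !(tnth_nth a) /= !nth_rcons size_tuple iN jn.
right; have [v [b uE]] := tuple_rconsP u; exists v.
have iE : i = n :> nat by apply: succn_inj; rewrite -ji.
move: tij; rewrite !(tnth_nth a) /= !nth_rcons size_tuple jn iE ltnSn ltnn eqxx uE.
by rewrite /= nth_rcons size_tuple ltnn eqxx => ->.
Qed.

Lemma degenerate_chain_h (a : X) n (c : rack_chain X n) :
  c \in degenerate_chain n -> h_map a c \in degenerate_chain n.+1.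
Proof.
apply: (gen_subgroup_sub (f := @h_map X a n)) => _ [t dt ->] /=.
by rewrite h_mapU; apply/degenerate_mem/degenerate_rcons.
Qed.

Lemma degenerate_chain_star (a : X) n (c : rack_chain X n) :
  c \in degenerate_chain n -> star_map a c \in degenerate_chain n.
Proof.
apply: (gen_subgroup_sub (f := @star_map X a n)) => _ [t [i [j [ji tij]]] ->] /=.
rewrite star_mapU; apply/degenerate_mem; exists i, j; split=> //.
by rewrite !tnth_map tij.
Qed.

Lemma star_map_h (a : X) n (c : rack_chain X n) :
  star_map a (h_map a c) = h_map a (star_map a c).
Proof.
move: c; apply: (freeg_additive_ext (f := @star_map X a n.+1 \o @h_map X a n)
  (g := @h_map X a n \o @star_map X a n)) => t /=.
rewrite !(h_mapU, star_mapU); congr << _ >>; apply: val_inj.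
by rewrite /= map_rcons rack_op_idem.
Qed.

Lemma degenerate_chain_hh (a : X) n (c : rack_chain X n) :
  h_map a (h_map a c) \in degenerate_chain n.+2.
Proof.
rewrite -[c]freeg_sumE !raddf_sum rpred_sum // => t _.
rewrite -[coeff t c]intz -freegU_mulz !raddfMz rpredMz //= !h_mapU.
apply: degenerate_mem; exists (widen_ord (leqnSn _) ord_max), ord_max; split=> //.
by rewrite !(tnth_nth a) /= !nth_rcons size_rcons size_tuple ltnSn ltnn eqxx ltnn eqxx.
Qed.

Lemma degenerate_chain_bd n (c : rack_chain X n.+1) :
  c \in degenerate_chain n.+1 -> rack_bd c \in degenerate_chain n.
Proof.
apply: (gen_subgroup_sub (f := @rack_bd X n)) => {c} _ [t dt ->] /=.
elim: n t dt => [|n IH] t; first by rewrite rack_bd0 rpred0.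
case/degenerate_rconsP=> u [a [-> duv]]; rewrite -h_mapU rack_bd_h.
case: duv => [du|[v uE]].
  rewrite rpredD ?degenerate_chain_h ?IH // rpredZsign.
  by rewrite rpredB ?degenerate_chain_star ?degenerate_mem.
rewrite uE -h_mapU star_map_h.
case: n v {IH u uE t} => [|n] v.
  rewrite rack_bd0 raddf0 add0r star_mapU (_ : map_tuple _ v = v) ?subrr ?scaler0 ?rpred0 //.
  by rewrite [LHS]tuple0 [RHS]tuple0.
rewrite rack_bd_h raddfD raddfZsign raddfB /= exprS mulN1r scaleNr addrK.
exact: degenerate_chain_hh.
Qed.

Definition degenerate_subcomplex : subcomplex (rack_complex X) :=
  @Subcomplex (rack_complex X) degenerate_chain degenerate_chain_bd.

Definition degenerate_complex : chain_complex :=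
  sub_complex degenerate_subcomplex.

Definition quandle_complex : chain_complex :=
  quot_complex degenerate_subcomplex.

Definition degenerate_val n (c : degenerate_complex n) : rack_complex X n :=
  val c.

Definition quandle_class n (c : rack_complex X n) : quandle_complex n :=
  quot_pi (degenerate_chain n) c.

End QuandleComplex.

(* Main.v *)
Require Import Defs.
From HB Require Import structures.
From mathcomp Require Import freeg.
From mathcomp Require Import all_boot all_order all_algebra.
From mathcomp Require Import boolp classical_sets functions cardinality.

(** Everything follows from two formulas: [star_map a] commutes with the
boundary ([rack_bd_star]), and
[bd (h_a x) = h_a (bd x) + (-1)^n (x - star_a x)] for [x] of degree [n + 1]
([rack_bd_h]).

The second formula says that [(-1)^n h_a] is a homotopy from the identity to
[star_a] ([star_homotopyP]).  Summing it over the translates [star_a^i h_a]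
makes the error terms [star_a^i x - star_a^(i+1) x] telescope to
[x - star_a^k x], which vanishes under the k-condition, so [h'_a] is a chain
map ([rack_bd_h']).

For the dependence on the orbit, write [b = a ** c].  Self-distributivity says
that translation by [c] carries translation by [a] to translation by [b], hence
[star_c h'_a = h'_b star_c] ([star_map_h'_op]).  Since [star_c] is homotopic to
the identity through some [t], both sides may be compared:
[h'_a] is homotopic to [star_c h'_a = h'_b star_c], which is homotopic to [h'_b],
and the explicit homotopy is [h'_b t - t h'_a] ([h'_homotopic_op]).  The relation
obtained in this way is an equivalence, so it propagates from the generators
[x |-> x ** c] to the whole group of translations and thus to orbits; inverse
translations are covered by symmetry.

All these homotopies are built from [h] and [star] by composition and addition.
They therefore preserve every graded subgroup stable under [h] and [star], in
particular the degenerate chains, and so restrict to the degenerate complex and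
descend to the quandle complex.  This is why the homotopies between the maps
[h'_a] are constructed once, on rack chains, with this stability recorded
([h'_homotopic]). *)

Set Implicit Arguments.
Unset Strict Implicit.
Unset Printing Implicit Defensive.

Import GRing.Theory.
Local Open Scope ring_scope.

(** * Chain maps on subcomplexes and quotient complexes *)

Section QuotientLift.
Variables (V W : zmodType) (S : zmodClosed V) (f : {additive V -> W}).
Hypothesis fS : forall x, x \in S -> f x = 0.

(** Taking the proof that [f] vanishes on [S] as an argument makes the function
determine its own additivity, so that it carries a canonical structure. *)
Definition quot_lift of (forall x, x \in S -> f x = 0) :=
  fun x : {ideal_quot S} => f (repr x).

Lemma quot_lift_pi x : quot_lift fS (quot_pi S x) = f x.
Proof.
by apply/eqP; rewrite -subr_eq0 /quot_lift -raddfB fS //; apply/quot_piP/quot_repr.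
Qed.

Fact quot_lift_zmod_morphism : zmod_morphism (quot_lift fS).
Proof.
move=> x y; rewrite -[x]quot_repr -[y]quot_repr -raddfB.
by rewrite !quot_lift_pi raddfB.
Qed.

HB.instance Definition _ := GRing.isZmodMorphism.Build
  {ideal_quot S} W (quot_lift fS) quot_lift_zmod_morphism.
End QuotientLift.

Section SubgroupRestriction.
Variables (V W : zmodType) (S : zmodClosed V) (T : zmodClosed W).
Variable f : {additive V -> W}.
Hypothesis fST : forall x, x \in S -> f x \in T.

Definition sub_restrict (x : subgroup_type S) : subgroup_type T :=
  exist _ (f (val x)) (fST (valP x)).

Fact sub_restrict_zmod_morphism : zmod_morphism sub_restrict.
Proof. by move=> x y; apply: val_inj; rewrite /= !raddfB. Qed.

HB.instance Definition _ := GRing.isZmodMorphism.Build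
  (subgroup_type S) (subgroup_type T) sub_restrict sub_restrict_zmod_morphism.
End SubgroupRestriction.

Definition chain_comp (C D E : chain_complex) (f : chain_map D E)
    (g : chain_map C D) : chain_map C E :=
  @ChainMap C E (fun n => f n \o g n)
    (fun n x => etrans (congr1 (f n) (cmapE g x)) (cmapE f (g n.+1 x))).

Definition chain_shift (C D : chain_complex) (f : chain_map C D) :
    chain_map (shift C) (shift D) :=
  @ChainMap (shift C) (shift D) (fun n => f n.+1) (fun n => cmapE f (n := n.+1)).

(** The target is an arbitrary complex rather than another quotient, so that the
same universal property gives endomorphisms of the quotient and, with a shifted
target, its maps of degree 1. *)
Section QuotientChainMap.
Variables (C E : chain_complex) (S : subcomplex C).

Section Factor.
Variable f : chain_map C E.
Hypothesis fS : forall n x, x \in S n -> f n x = 0.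

Fact quot_chain_map_subproof n x :
  quot_lift (@fS n) (bd (quot_complex S) n x) =
  bd E n (quot_lift (@fS n.+1) x).
Proof.
rewrite -[x]quot_repr /= quot_bd_pi !quot_lift_pi; exact: cmapE.
Qed.

Definition quot_chain_map : chain_map (quot_complex S) E :=
  @ChainMap (quot_complex S) E (fun n => quot_lift (@fS n))
    quot_chain_map_subproof.

Lemma quot_chain_map_pi n x : quot_chain_map n (quot_pi (S n) x) = f n x.
Proof. exact: quot_lift_pi. Qed.
End Factor.

(** A homotopy into [E] that is defined on [C] and kills [S] factors through the
quotient.  The maps [f] and [g] are arbitrary so that one of them may be the
identity of the quotient. *)
Lemma quot_chain_homotopic (f g : chain_map (quot_complex S) E)
    (s : forall n, {additive C n -> E n.+1}) :
  (forall n x, x \in S n -> s n x = 0) ->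
  (forall n x, f n.+1 (quot_pi (S n.+1) x) - g n.+1 (quot_pi (S n.+1) x) =
     bd E n.+1 (s n.+1 x) + s n (bd C n x)) ->
  chain_homotopic f g.
Proof.
move=> sS sE; exists (fun n => quot_lift (@sS n)) => n x.
by rewrite -[x]quot_repr sE /= quot_bd_pi !quot_lift_pi.
Qed.

End QuotientChainMap.

Section SubcomplexMap.
Variables (C : chain_complex) (S : subcomplex C).

Section Restrict.
Variable f : chain_map C (shift C).
Hypothesis fS : forall n x, x \in S n -> f n x \in S n.+1.

Fact sub_chain_map_subproof n x :
  sub_restrict (@fS n) (bd (sub_complex S) n x) =
  bd (shift (sub_complex S)) n (sub_restrict (@fS n.+1) x).
Proof. by apply: val_inj; exact: cmapE. Qed.

Definition sub_chain_map : chain_map (sub_complex S) (shift (sub_complex S)) :=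
  @ChainMap (sub_complex S) (shift (sub_complex S))
    (fun n => sub_restrict (@fS n)) sub_chain_map_subproof.
End Restrict.

Lemma sub_chain_homotopic (f g : chain_map C (shift C))
    (fS : forall n x, x \in S n -> f n x \in S n.+1)
    (gS : forall n x, x \in S n -> g n x \in S n.+1)
    (s : forall n, {additive C n -> C n.+2}) :
  (forall n x, x \in S n -> s n x \in S n.+2) ->
  (forall n x, f n.+1 x - g n.+1 x = bd C n.+2 (s n.+1 x) + s n (bd C n x)) ->
  chain_homotopic (sub_chain_map fS) (sub_chain_map gS).
Proof.
move=> sS sE; exists (fun n => sub_restrict (@sS n)) => n x.
by apply: val_inj; exact: sE.
Qed.

End SubcomplexMap.

(** On a cycle the term of the homotopy identity that involves the boundary
vanishes, so the two images differ by a boundary. *)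
Lemma chain_homotopic_homology (C D : chain_complex) (f g : chain_map C D) n x :
  chain_homotopic f g -> homology_map f n x = homology_map g n x.
Proof.
case=> s sE; rewrite -[x]quot_repr -/(homology_class _) !homology_map_class.
apply/quot_piP/asboolP; exists (s n.+1 (val (repr x))).
case: (repr x) => z zc; move: (zc); rewrite /= inE => /eqP z0.
by rewrite sE z0 raddf0 addr0.
Qed.

(** * The operators on rack chains *)

Section RackMaps.
Variable X : rackType.
Implicit Types (a b c : X) (k n : nat).

Fact iter_star_map_zmod_morphism a i n :
  zmod_morphism (iter i (@star_map X a n)).
Proof. by elim: i => // i IH x y; rewrite /= IH raddfB. Qed.

HB.instance Definition _ a i n := GRing.isZmodMorphism.Build
  (rack_chain X n) (rack_chain X n) (iter i (@star_map X a n))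
  (@iter_star_map_zmod_morphism a i n).

Fact h'_map_zmod_morphism a k n : zmod_morphism (@h'_map X a k n).
Proof. by move=> x y; rewrite -sumrB; apply: eq_bigr => i _; rewrite !raddfB. Qed.

HB.instance Definition _ a k n := GRing.isZmodMorphism.Build
  (rack_chain X n) (rack_chain X n.+1) (@h'_map X a k n)
  (@h'_map_zmod_morphism a k n).

Definition star_homotopy c n (x : rack_chain X n) : rack_chain X n.+1 :=
  (-1) ^+ n *: h_map c x.

Fact star_homotopy_zmod_morphism c n : zmod_morphism (@star_homotopy c n).
Proof. by move=> x y; rewrite /star_homotopy raddfB scalerBr. Qed.

HB.instance Definition _ c n := GRing.isZmodMorphism.Build
  (rack_chain X n) (rack_chain X n.+1) (@star_homotopy c n)
  (@star_homotopy_zmod_morphism c n).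

(** The alternating sign in [star_homotopy] makes the two terms [h_c (bd x)]
cancel. *)
Lemma star_homotopyP c n (x : rack_chain X n.+1) :
  star_map c x - x =
  rack_bd (star_homotopy c x) + star_homotopy c (rack_bd x).
Proof.
rewrite /star_homotopy raddfZsign /= rack_bd_h scalerDr scalerA exprS mulN1r.
by rewrite mulNr -expr2 sqrr_sign !scaleNr scale1r opprB addrAC addNr add0r.
Qed.

Lemma iter_star_mapU a i n (t : n.-tuple X) :
  iter i (@star_map X a n) << t >> =
  << map_tuple (iter i (fun x => x ** a)) t >>.
Proof.
elim: i => [|i /= ->]; first by congr << _ >>; apply: val_inj; rewrite /= map_id.
by rewrite star_mapU; congr << _ >>; apply: val_inj; rewrite /= -map_comp.
Qed.

Lemma iter_star_map_id a k n (x : rack_chain X n) :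
  k_condition a k -> iter k (@star_map X a n) x = x.
Proof.
case=> _ ak; move: x.
apply: (freeg_additive_ext (f := iter k (@star_map X a n)) (g := idfun)) => t /=.
rewrite iter_star_mapU; congr << _ >>; apply: val_inj => /=.
by rewrite (eq_map ak) map_id.
Qed.

Lemma rack_bd_iter_star a i n (x : rack_chain X n.+1) :
  rack_bd (iter i (@star_map X a n.+1) x) =
  iter i (@star_map X a n) (rack_bd x).
Proof. by elim: i => //= i <-; rewrite rack_bd_star. Qed.

(** The boundary of the [i]-th summand of [h'_a] is the [i]-th summand of
[h'_a (bd x)] plus a difference of consecutive iterates of [star_a] on [x];
those differences telescope, and the k-condition closes the cycle. *)
Lemma rack_bd_h' a k n (x : rack_chain X n.+1) :
  k_condition a k -> h'_map a k (rack_bd x) = rack_bd (h'_map a k x).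
Proof.
move=> ak; rewrite /h'_map raddf_sum /=; apply/esym.
pose g i := - ((-1) ^+ n *: iter i (@star_map X a n.+1) x).
rewrite (eq_bigr (fun i : 'I_k => iter i (@star_map X a n.+1) (h_map a (rack_bd x))
   + (g i.+1 - g i))); last first.
  move=> i _; rewrite rack_bd_iter_star rack_bd_h raddfD raddfZsign raddfB /=.
  by rewrite -iterSr /= /g scalerBr opprK [- _ + _]addrC.
rewrite big_split /= -(big_mkord xpredT (fun i => g i.+1 - g i)) telescope_sumr //.
by rewrite /g iter_star_map_id // subrr addr0.
Qed.

Definition star_chain_map a : chain_map (rack_complex X) (rack_complex X) :=
  @ChainMap (rack_complex X) (rack_complex X) (fun n => @star_map X a n)
    (fun n x => esym (rack_bd_star a x)).

Definition h'_chain_map a k (ak : k_condition a k) :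
    chain_map (rack_complex X) (shift (rack_complex X)) :=
  @ChainMap (rack_complex X) (shift (rack_complex X)) (fun n => @h'_map X a k n)
    (fun n x => rack_bd_h' x ak).

Lemma rack_op_inj c : injective (fun x : X => x ** c).
Proof.
move=> x y /= xy; have [z [_ zU]] := rack_op_bij (x ** c) c.
by rewrite -(zU x) // -(zU y).
Qed.

(** An injective map of a finite set permutes each of its orbits cyclically, and
the length of each cycle divides the factorial of the cardinality. *)
Lemma finite_k_condition a :
  finite_set [set: X]%classic -> exists k, k_condition a k.
Proof.
case/finite_seqP=> s sE.
have sX x : x \in s by have : [set: X]%classic x by []; rewrite sE.
pose g (x : seq_sub s) : seq_sub s := SeqSub (sX (ssval x ** a)).
have g_inj : injective g by move=> x y [/rack_op_inj xy]; apply: val_inj.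
have gE i x : ssval (iter i g x) = iter i (fun y => y ** a) (ssval x).
  by elim: i => //= i ->.
exists ((#|{: seq_sub s}|)`!); split=> [|x]; first exact: fact_gt0.
rewrite -[x]/(ssval (SeqSub (sX x))) -gE.
set u := SeqSub _.
have /dvdnP[q ->] : (order g u %| (#|{: seq_sub s}|)`!)%N.
  by rewrite dvdn_fact // order_gt0 max_card.
by rewrite iterM; congr ssval; elim: q => //= q ->; rewrite iter_order.
Qed.

(** * Dependence of the degree one maps on the orbit *)

(** Translation by [c] conjugates translation by [a] to translation by
[a ** c]. *)
Lemma iter_op_distr a c i x :
  iter i (fun y => y ** (a ** c)) (x ** c) = iter i (fun y => y ** a) x ** c.
Proof. by elim: i => //= i ->; rewrite [RHS]rack_op_distr. Qed.

Lemma k_condition_op a c k : k_condition a k <-> k_condition (a ** c) k.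
Proof.
split=> -[k0 ak]; split=> // x; last first.
  by apply: (@rack_op_inj c); rewrite /= -iter_op_distr ak.
by have [y [-> _]] := rack_op_bij x c; rewrite iter_op_distr ak.
Qed.

Lemma star_map_h_op a c n (x : rack_chain X n) :
  star_map c (h_map a x) = h_map (a ** c) (star_map c x).
Proof.
move: x; apply: (freeg_additive_ext (f := @star_map X c n.+1 \o @h_map X a n)
  (g := @h_map X (a ** c) n \o @star_map X c n)) => t /=.
by rewrite !(h_mapU, star_mapU); congr << _ >>; apply: val_inj; rewrite /= map_rcons.
Qed.

Lemma star_map_star_op a c n (x : rack_chain X n) :
  star_map c (star_map a x) = star_map (a ** c) (star_map c x).
Proof.
move: x; apply: (freeg_additive_ext (f := @star_map X c n \o @star_map X a n)
  (g := @star_map X (a ** c) n \o @star_map X c n)) => t /=.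
rewrite !star_mapU; congr << _ >>; apply: val_inj; rewrite /= -!map_comp.
by apply: eq_map => y; rewrite /= rack_op_distr.
Qed.

(** Automorphisms act naturally on the maps [h'], and [x |-> x ** c] is an
automorphism taking [a] to [a ** c]. *)
Lemma star_map_h'_op a c k n (x : rack_chain X n) :
  star_map c (h'_map a k x) = h'_map (a ** c) k (star_map c x).
Proof.
rewrite /h'_map raddf_sum; apply: eq_bigr => i _ /=.
by elim: (val i) => [|j IH] /=; rewrite ?star_map_h_op // star_map_star_op IH.
Qed.

(** The property of the degenerate chains that lets homotopies restrict to them
and pass to the quotient by them. *)
Definition op_stable (S : forall n, zmodClosed (rack_chain X n)) :=
  forall a n x, x \in S n -> h_map a x \in S n.+1 /\ star_map a x \in S n.

Lemma op_stable_h' S a k n x : op_stable S -> x \in S n -> h'_map a k x \in S n.+1.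
Proof.
move=> Sop xS; apply: rpred_sum => i _.
by elim: (val i) => [|j IH] /=; [case: (Sop a _ _ xS) | case: (Sop a _ _ IH)].
Qed.

Lemma op_stable_homotopy S c n x :
  op_stable S -> x \in S n -> star_homotopy c x \in S n.+1.
Proof. by move=> Sop xS; rewrite rpredZsign; case: (Sop c _ _ xS). Qed.

(** A chain homotopy that is natural enough to preserve all stable families at
once.  It is stated for the maps themselves, without the
k-condition that makes them chain maps, so that it is an equivalence relation
on all of [X]. *)
Definition h'_homotopic k a b :=
  exists s : forall n, {additive rack_chain X n -> rack_chain X n.+2},
    (forall n x, h'_map a k x - h'_map b k x =
       rack_bd (s n.+1 x) + s n (rack_bd x)) /\
    (forall S, op_stable S -> forall n x, x \in S n -> s n x \in S n.+2).

Lemma h'_homotopic_refl k a : h'_homotopic k a a.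
Proof.
exists (fun n => \0); split=> [n x|S _ n x _] /=; last exact: rpred0.
by rewrite raddf0 subrr addr0.
Qed.

Lemma h'_homotopic_sym k a b : h'_homotopic k a b -> h'_homotopic k b a.
Proof.
case=> s [sE sS]; exists (fun n => \- (s n)); split=> [n x|S Sop n x xS] /=.
  by rewrite raddfN -opprD -sE opprB.
by rewrite rpredN sS.
Qed.

Lemma h'_homotopic_trans k a b c :
  h'_homotopic k a b -> h'_homotopic k b c -> h'_homotopic k a c.
Proof.
case=> s [sE sS] [t [tE tS]]; exists (fun n => s n \+ t n).
split=> [n x|S Sop n x xS] /=; last by rewrite rpredD ?sS ?tS.
by rewrite raddfD addrACA -sE -tE addrA subrK.
Qed.

(** Difference of the two ways of applying the homotopy [t] from the identity to
[star_c]: after [h'_a], and before [h'_(a ** c)].  Both paths meet at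
[star_c h'_a = h'_(a ** c) star_c]. *)
Lemma h'_homotopic_op k a c : k_condition a k -> h'_homotopic k a (a ** c).
Proof.
move=> ak; have bk := (k_condition_op a c k).1 ak.
exists (fun n => (@h'_map X (a ** c) k n.+1 \o @star_homotopy c n) \-
                 (@star_homotopy c n.+1 \o @h'_map X a k n)).
split=> [n x|S Sop n x xS] /=; last first.
  by rewrite rpredB ?(op_stable_h', op_stable_homotopy).
(* Group the terms into [h'_b (star_c x - x)] and [star_c (h'_a x) - h'_a x]. *)
rewrite raddfB /= -(rack_bd_h' _ bk) (rack_bd_h' x ak) addrACA -opprD -star_homotopyP.
rewrite -raddfD -star_homotopyP raddfB /= star_map_h'_op opprB.
by rewrite addrC addrA subrK addrC.
Qed.

(** The k-condition has to be transported along with the homotopy, in both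
directions, because compositions and inverses of translations move the base
point at which the induction hypothesis is used. *)
Lemma h'_homotopic_translation k f : translation_group f ->
  forall a, (k_condition a k <-> k_condition (f a) k) /\
    (k_condition a k -> h'_homotopic k a (f a)).
Proof.
elim=> {f} [c|| f g _ IHf _ IHg|f g _ IHf fK gK] a.
- by split; [exact: k_condition_op | exact: h'_homotopic_op].
- by split=> // _; exact: h'_homotopic_refl.
- have [fk fh] := IHf (g a); have [gk gh] := IHg a.
  split=> [|ak]; first exact: iff_trans gk fk.
  by apply: h'_homotopic_trans (gh ak) (fh _); apply/gk.
have [] := IHf (g a); rewrite gK => gk gh; split=> [|/gk ak]; first exact: iff_sym.
exact/h'_homotopic_sym/gh.
Qed.

Lemma same_orbit_h'_homotopic k a b :
  k_condition a k -> same_orbit a b -> h'_homotopic k a b.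
Proof. by move=> ak [f /h'_homotopic_translation fP <-]; apply: (fP k a).2. Qed.

Lemma star_chain_map_homotopic a :
  chain_homotopic (star_chain_map a) (chain_id (rack_complex X)).
Proof. by exists (@star_homotopy a) => n x; exact: star_homotopyP. Qed.

Lemma h'_chain_map_homotopic a b k (ak : k_condition a k) (bk : k_condition b k) :
  same_orbit a b -> chain_homotopic (h'_chain_map ak) (h'_chain_map bk).
Proof. by case/(same_orbit_h'_homotopic ak)=> s [sE _]; exists s => n x; exact: sE. Qed.

End RackMaps.

(** * The quandle and degenerate complexes *)

Section QuandleMaps.
Variable X : quandleType.
Implicit Types a b : X.

Lemma degenerate_op_stable : op_stable (degenerate_chain X).
Proof.
by move=> a n x xD; split; [exact: degenerate_chain_h | exact: degenerate_chain_star].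
Qed.

Definition quandle_class_map : chain_map (rack_complex X) (quandle_complex X) :=
  @ChainMap (rack_complex X) (quandle_complex X)
    (fun n => @quot_pi _ (degenerate_chain X n))
    (fun n x => esym (quot_bd_pi (degenerate_subcomplex X) x)).

Lemma quandle_class_eq0 n (x : rack_chain X n) :
  x \in degenerate_chain X n -> quot_pi (degenerate_chain X n) x = 0.
Proof.
by move=> xD; rewrite -(raddf0 (quot_pi (degenerate_chain X n))); apply/quot_piP;
   rewrite subr0.
Qed.

Fact quandle_star_subproof a n (x : rack_complex X n) :
  x \in degenerate_subcomplex X n ->
  chain_comp quandle_class_map (star_chain_map a) n x = 0.
Proof. by move=> xD; apply/quandle_class_eq0/degenerate_chain_star. Qed.

Definition quandle_star a : chain_map (quandle_complex X) (quandle_complex X) :=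
  quot_chain_map (@quandle_star_subproof a).

Fact quandle_h'_subproof a k (ak : k_condition a k) n (x : rack_complex X n) :
  x \in degenerate_subcomplex X n ->
  chain_comp (chain_shift quandle_class_map) (h'_chain_map ak) n x = 0.
Proof. by move=> xD; apply/quandle_class_eq0/op_stable_h'/xD/degenerate_op_stable. Qed.

Definition quandle_h' a k (ak : k_condition a k) :
    chain_map (quandle_complex X) (shift (quandle_complex X)) :=
  quot_chain_map (@quandle_h'_subproof a k ak).

Lemma quandle_star_class a n (c : rack_chain X n) :
  quandle_star a n (quandle_class c) = quandle_class (star_map a c).
Proof. exact: quot_chain_map_pi. Qed.

Lemma quandle_h'_class a k (ak : k_condition a k) n (c : rack_chain X n) :
  quandle_h' ak n (quandle_class c) = quandle_class (h'_map a k c).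
Proof. exact: quot_chain_map_pi. Qed.

Fact quandle_h_subproof a n (x : rack_chain X n) :
  x \in degenerate_chain X n ->
  (quot_pi (degenerate_chain X n.+1) \o @h_map X a n) x = 0.
Proof. by move=> xD; apply/quandle_class_eq0/degenerate_chain_h. Qed.

Definition quandle_h a n : {additive quandle_complex X n -> quandle_complex X n.+1} :=
  quot_lift (@quandle_h_subproof a n).

Lemma quandle_star_homotopic a :
  chain_homotopic (quandle_star a) (chain_id (quandle_complex X)).
Proof.
apply: (@quot_chain_homotopic (rack_complex X) (quandle_complex X)
  (degenerate_subcomplex X) (quandle_star a) (chain_id (quandle_complex X))
  (fun n => quandle_class_map n.+1 \o @star_homotopy X a n)).
  move=> n x xD; apply/quandle_class_eq0/op_stable_homotopy/xD.
  exact: degenerate_op_stable.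
move=> n x; rewrite quandle_star_class /= -raddfB star_homotopyP raddfD.
by congr (_ + _); exact: (cmapE quandle_class_map).
Qed.

Lemma quandle_h'_homotopic a b k (ak : k_condition a k) (bk : k_condition b k) :
  same_orbit a b -> chain_homotopic (quandle_h' ak) (quandle_h' bk).
Proof.
case/(same_orbit_h'_homotopic ak)=> s [sE sS].
apply: (@quot_chain_homotopic (rack_complex X) (shift (quandle_complex X))
  (degenerate_subcomplex X) (quandle_h' ak) (quandle_h' bk)
  (fun n => quandle_class_map n.+2 \o s n)).
  by move=> n x xD; apply/quandle_class_eq0/sS/xD/degenerate_op_stable.
move=> n x; rewrite !quandle_h'_class /quandle_class -raddfB sE raddfD.
by congr (_ + _); exact: (cmapE (chain_shift quandle_class_map)).
Qed.

Definition degenerate_h' a k (ak : k_condition a k) :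
    chain_map (degenerate_complex X) (shift (degenerate_complex X)) :=
  @sub_chain_map _ (degenerate_subcomplex X) (h'_chain_map ak)
    (fun n x => op_stable_h' a k degenerate_op_stable).

Lemma degenerate_h'_homotopic a b k (ak : k_condition a k) (bk : k_condition b k) :
  same_orbit a b -> chain_homotopic (degenerate_h' ak) (degenerate_h' bk).
Proof.
case/(same_orbit_h'_homotopic ak)=> s [sE sS].
apply: (@sub_chain_homotopic (rack_complex X) (degenerate_subcomplex X)
  (h'_chain_map ak) (h'_chain_map bk) _ _ s); last exact: sE.
exact: sS degenerate_op_stable.
Qed.

End QuandleMaps.

Theorem proposition2p1 :
  (forall X : rackType,
    (* (i) *)
    (forall a : X,
      exists f : chain_map (rack_complex X) (rack_complex X),
        (forall n c, f n c = star_map a c) /\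
        chain_homotopic f (chain_id (rack_complex X))) /\
    (* (ii) *)
    (forall (a : X) k, k_condition a k ->
      exists f : chain_map (rack_complex X) (shift (rack_complex X)),
        forall n c, f n c = h'_map a k c) /\
    (finite_set [set: X]%classic ->
      forall a : X, exists k, k_condition a k) /\
    (* (iv), W = R *)
    (forall (a b : X) k, k_condition a k -> k_condition b k -> same_orbit a b ->
      exists f g : chain_map (rack_complex X) (shift (rack_complex X)),
        (forall n c, f n c = h'_map a k c) /\
        (forall n c, g n c = h'_map b k c) /\
        (forall n x, homology_map f n x = homology_map g n x))) /\
  (forall X : quandleType,
    (* (iii) *)
    (forall (a : X) n (c : rack_chain X n), c \in degenerate_chain X n ->
      h_map a c \in degenerate_chain X n.+1 /\
      star_map a c \in degenerate_chain X n) /\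
    (forall a : X,
      exists f : forall n,
          {additive quandle_complex X n -> quandle_complex X n.+1},
        forall n (c : rack_chain X n),
          f n (quandle_class c) = quandle_class (h_map a c)) /\
    (forall (a : X) k, k_condition a k ->
      exists f : chain_map (quandle_complex X) (shift (quandle_complex X)),
        forall n (c : rack_chain X n),
          f n (quandle_class c) = quandle_class (h'_map a k c)) /\
    (forall a : X,
      exists f : chain_map (quandle_complex X) (quandle_complex X),
        (forall n (c : rack_chain X n),
          f n (quandle_class c) = quandle_class (star_map a c)) /\
        chain_homotopic f (chain_id (quandle_complex X))) /\
    (* (iv), W = Q *)
    (forall (a b : X) k, k_condition a k -> k_condition b k -> same_orbit a b ->
      exists f g : chain_map (quandle_complex X) (shift (quandle_complex X)),
        (forall n (c : rack_chain X n),
          f n (quandle_class c) = quandle_class (h'_map a k c)) /\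
        (forall n (c : rack_chain X n),
          g n (quandle_class c) = quandle_class (h'_map b k c)) /\
        (forall n x, homology_map f n x = homology_map g n x)) /\
    (* (iv), W = D *)
    (forall (a b : X) k, k_condition a k -> k_condition b k -> same_orbit a b ->
      exists f g :
          chain_map (degenerate_complex X) (shift (degenerate_complex X)),
        (forall n (c : degenerate_complex X n),
          degenerate_val (n := n.+1) (f n c) = h'_map a k (degenerate_val c)) /\
        (forall n (c : degenerate_complex X n),
          degenerate_val (n := n.+1) (g n c) = h'_map b k (degenerate_val c)) /\
        (forall n x, homology_map f n x = homology_map g n x))).
Proof.
split=> X.
  split=> [a|].
    exists (star_chain_map a); split=> //; exact: star_chain_map_homotopic.
  split=> [a k ak|]; first by exists (h'_chain_map ak).
  split=> [Xfin a|a b k ak bk ab]; first exact: finite_k_condition.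
  exists (h'_chain_map ak), (h'_chain_map bk); do 2![split=> //] => n x.
  exact/chain_homotopic_homology/h'_chain_map_homotopic.
split=> [a n c cD|]; first exact: degenerate_op_stable.
split=> [a|].
  exists (quandle_h a) => n c; exact: quot_lift_pi.
split=> [a k ak|]; first by exists (quandle_h' ak) => n c; exact: quandle_h'_class.
split=> [a|].
  exists (quandle_star a); split=> [n c|]; first exact: quandle_star_class.
  exact: quandle_star_homotopic.
split=> a b k ak bk ab.
  exists (quandle_h' ak), (quandle_h' bk).
  split=> [n c|]; first exact: quandle_h'_class.
  split=> [n c|]; first exact: quandle_h'_class.
  by move=> n x; exact/chain_homotopic_homology/quandle_h'_homotopic.
exists (degenerate_h' ak), (degenerate_h' bk); do 2![split=> //] => n x.
exact/chain_homotopic_homology/degenerate_h'_homotopic.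
Qed.
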